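(* Let $\mathcal{M}=(\mathcal{E},\mathcal{I})$ be a matroid and suppose there is a $\gamma$-competitive online algorithm for the matroid secretary problem on $\mathcal{M}$. Then for every $\alpha\ge1$, every $\alpha$-uncontentious distribution $\mathcal{D}$ on $2^{\mathcal{E}}$ admits an online $\gamma\alpha$-competitive contention resolution map. In other words, for every $\alpha$ there exists an online $\gamma\alpha$-competitive $\alpha$-universal contention resolution scheme for $\mathcal{M}$.
   Context: Matroid secretary problem on $\mathcal{M}$: nonnegative weights $w$ on $\mathcal{E}$ are chosen adversarially; elements arrive in a uniformly random order, the weight of each is revealed on arrival, and the algorithm (which knows $\mathcal{M}$) must irrevocably accept or reject it, accepting an independent set. It is $\gamma$-competitive if for every $w$ the expected weight accepted is at least $1/\gamma$ times the maximum weight of an independent set. A contention resolution map (CRM) is a randomized function $\phi:2^{\mathcal{E}}\to\mathcal{I}$ with $\phi(R)\subseteq R$; it is $\alpha$-competitive for $\mathcal{D}$ if $\Pr_{R\sim\mathcal{D}}[i\in R]\le\alpha\Pr[i\in\phi(R)]$ for all $i$. $\mathcal{D}$ is $\alpha$-uncontentious if it admits an $\alpha$-competitive CRM. An online (random-order) CRM is a CRM implementable as follows: $R\sim\mathcal{D}$ is drawn, the elements of $\mathcal{E}$ arrive in a uniformly random order independent of $R$, upon arrival of $e$ the algorithm learns whether $e\in R$ and if so must irrevocably decide whether to include $e$ in $\phi(R)$; the online CRM may depend on (know) $\mathcal{D}$. A contention resolution scheme is a collection of CRMs $\phi_{\mathcal{D}}$, one per distribution; it is $\alpha$-universal $\beta$-competitive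 if $\phi_{\mathcal{D}}$ is $\beta$-competitive for every $\alpha$-uncontentious $\mathcal{D}$. *)

(* Defs.v *)
From HB Require Import structures.
From mathcomp Require Import all_boot all_order all_algebra all_fingroup.
From mathcomp Require Import all_classical all_reals all_analysis.

Set Implicit Arguments.
Unset Strict Implicit.
Unset Printing Implicit Defensive.

Import Order.TTheory GRing.Theory Num.Theory.

Local Open Scope ring_scope.

Record matroid (E : finType) := Matroid {
  indep : {set E} -> bool;
  indep0 : indep finset.set0;
  indepS : forall A B : {set E}, A \subset B -> indep B -> indep A;
  indep_aug : forall A B : {set E}, indep A -> indep B -> (#|A| < #|B|)%N ->
    exists2 x, x \in B :\: A & indep (x |: A) }.

Record dist (R : realType) (T : finType) := Dist {
  dist_mass :> T -> R;
  dist_ge0 : forall x, 0 <= dist_mass x;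
  dist_sum1 : \sum_x dist_mass x = 1 }.

Definition pr (R : realType) (T : finType) (D : dist R T) (B : pred T) : R :=
  \sum_(x | B x) D x.

(** * Contention resolution maps *)

(* A randomized map is given by its kernel: [phi A S] is the probability that
   the (fresh) random choice made on input [A] is [S]. *)
Record crm (R : realType) (E : finType) (M : matroid E) := Crm {
  crm_law :> {set E} -> dist R {set E};
  crm_supp : forall A S : {set E},
    crm_law A S != 0 -> (S \subset A) && indep M S }.

Definition crm_competitive (R : realType) (E : finType) (M : matroid E)
    (alpha : R) (D : dist R {set E}) (phi : crm R M) : Prop :=
  forall i : E,
    pr D (fun A => i \in A)
      <= alpha * \sum_(A : {set E}) D A * pr (phi A) (fun S => i \in S).

Definition uncontentious (R : realType) (E : finType) (M : matroid E)
    (alpha : R) (D : dist R {set E}) : Prop :=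
  exists phi : crm R M, crm_competitive alpha D phi.

(** * Online algorithms in the random-order model *)

(* A deterministic policy maps the sequence of arrivals so far, each with the
   data of type [X] revealed on arrival, to the decision on the last of them.
   Earlier decisions are functions of this sequence, so they are not recorded. *)
Definition policy (E : finType) (X : Type) : Type := seq (E * X) -> bool.

Definition accepted (E : finType) (X : Type) (a : policy E X) (x : E -> X)
    (s : seq E) : {set E} :=
  [set e | a [seq (i, x i) | i <- take (index e s).+1 s]].

(* A randomized algorithm draws a seed, independently of the input and of the
   arrival order, and then follows the corresponding deterministic policy. *)
Record online_alg (R : realType) (E : finType) (X : Type) := OnlineAlg {
  seed_display : measure_display;
  seed : measurableType seed_display;
  seed_law : probability seed R;
  policy_of : seed -> policy E X;
  policy_measurable : forall h : seq (E * X),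
    measurable [set t | policy_of t h]%classic }.

(* Each ordering of [E] is [arrival s] for exactly one [s]. *)
Definition arrival (E : finType) (s : {perm E}) : seq E :=
  [seq s e | e <- enum E].

(* Probability that [out], a function of the policy and of the arrival order,
   equals [S], for a random seed and a uniformly random arrival order. *)
Definition outcome_prob (R : realType) (E : finType) (X : Type)
    (g : online_alg R E X) (out : policy E X -> seq E -> {set E})
    (S : {set E}) : R :=
  #|{perm E}|%:R^-1 *
    \sum_(s : {perm E})
      fine (seed_law g [set t | out (policy_of t) (arrival s) = S]%classic).

(** * The matroid secretary problem *)

Definition set_weight (R : realType) (E : finType) (w : E -> R)
    (S : {set E}) : R := \sum_(e in S) w e.

Definition max_indep_weight (R : realType) (E : finType) (M : matroid E)
    (w : E -> R) : R :=
  \big[Num.max/0]_(S : {set E} | indep M S) set_weight w S.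

Definition secretary_feasible (R : realType) (E : finType) (M : matroid E)
    (g : online_alg R E R) : Prop :=
  forall (t : seed g) (w : E -> R) (s : {perm E}), (forall e, 0 <= w e) ->
    indep M (accepted (policy_of t) w (arrival s)).

Definition expected_weight (R : realType) (E : finType)
    (g : online_alg R E R) (w : E -> R) : R :=
  \sum_(S : {set E})
    outcome_prob g (fun a s => accepted a w s) S * set_weight w S.

Definition secretary_competitive (R : realType) (E : finType) (M : matroid E)
    (gamma : R) (g : online_alg R E R) : Prop :=
  forall w : E -> R, (forall e, 0 <= w e) ->
    gamma^-1 * max_indep_weight M w <= expected_weight g w.

(** * Online contention resolution *)

(* The datum revealed when [e] arrives is whether [e] is in [A]; the decision is
   void for the elements outside [A]. *)
Definition crm_run (E : finType) (A : {set E}) (a : policy E bool)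
    (s : seq E) : {set E} :=
  A :&: accepted a (fun e => e \in A) s.

Definition online_crm (R : realType) (E : finType) (M : matroid E)
    (phi : crm R M) : Prop :=
  exists g : online_alg R E bool,
    (forall (t : seed g) (A : {set E}) (s : {perm E}),
       indep M (crm_run A (policy_of t) (arrival s))) /\
    (forall A S : {set E}, phi A S = outcome_prob g (crm_run A) S).

Definition crs (R : realType) (E : finType) (M : matroid E) : Type :=
  dist R {set E} -> crm R M.

Definition crs_universal (R : realType) (E : finType) (M : matroid E)
    (alpha beta : R) (Phi : crs R M) : Prop :=
  forall D : dist R {set E},
    uncontentious M alpha D -> crm_competitive beta D (Phi D).

Definition online_crs (R : realType) (E : finType) (M : matroid E)
    (Phi : crs R M) : Prop :=
  forall D : dist R {set E}, online_crm (Phi D).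

(* Main.v *)
Require Import Defs.
From mathcomp Require Import all_boot all_order all_algebra all_fingroup.
From mathcomp Require Import all_classical all_reals all_analysis.
From mathcomp Require Import ring lra.

(* Fix an [alpha]-uncontentious [D] and weights [w >= 0]. Feeding the secretary
   algorithm the weight [w e] when [e] is in the random set and [0] otherwise
   gives an online contention resolution map. As [D] has an [alpha]-competitive
   map, the expected maximum [w]-weight of an independent subset of the random
   set is at least [1/alpha] times its expected weight; so the online map selects
   in expectation a [1/(gamma * alpha)] fraction of that weight. Up to the way it
   acts on pairs (random set, arrival order), there are finitely many
   deterministic online maps, so the minimax theorem of finite games turns "for
   every [w] some online map is good on average over [w]" into "one mixture of
   online maps is good for every element". *)

Set Implicit Arguments.
Unset Strict Implicit.
Unset Printing Implicit Defensive.

Import Order.TTheory GRing.Theory Num.Theory numFieldNormedType.Exports.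

Local Open Scope ring_scope.

(** * A theorem of the alternative for finite matrices, by compactness *)

(** If [c > 0], the instance [t = 1] forces [d > 0], and then the bound fails at [t = c / (c + d)].
    It serves as a first-order optimality condition, [t * d] being a second-order remainder divided
    by [t]. *)
Lemma le0_of_small_slope (R : realFieldType) (c d : R) :
  (forall t, 0 < t -> t <= 1 -> c <= t * d) -> c <= 0.
Proof.
move=> h; rewrite leNgt; apply/negP => c0.
have d0 : 0 < d by have := h 1 ltr01 (lexx _); lra.
have cd : c / (c + d) <= 1 by rewrite ler_pdivrMr; lra.
have := h _ (divr_gt0 c0 (addr_gt0 c0 d0)) cd.
rewrite mulrAC -mulrA ler_pMr // leNgt ltr_pdivrMr; last lra.
by rewrite mul1r ltrDr c0.
Qed.

(* The mixture minimizes the sum of the squared negative parts [w] of the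
   coordinates over the simplex; if [w] were nonzero, moving towards the row [i]
   that [w] provides would decrease it. *)
Lemma ville_alternative (R : realType) (I J : finType) (a : I -> J -> R) :
  (forall w : J -> R, (forall j, 0 <= w j) ->
     exists i, 0 <= \sum_j w j * a i j) ->
  exists p : I -> R,
    [/\ forall i, 0 <= p i, \sum_i p i = 1 & forall j, 0 <= \sum_i p i * a i j].
Proof.
move=> hw.
have [i0 _] : exists i0 : I, True.
  by have [//|i _] := hw (fun=> 0); exists i.
pose n := #|I|.
(* The simplex of mixtures, in row vectors so that [EVT_min_rV] applies. *)
pose S : set 'rV[R]_n := (
  [set v : 'rV[R]_n | forall k, `[0, 1]%classic (v ord0 k)] `&`
  (fun v : 'rV[R]_n => (\sum_k v ord0 k : R)) @^-1` [set 1])%classic.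
pose x (v : 'rV[R]_n) j : R := \sum_k v ord0 k * a (enum_val k) j.
pose F (v : 'rV[R]_n) : R := \sum_j Num.max 0 (- x v j) ^+ 2.
have cc k : continuous (fun v : 'rV[R]_n => v ord0 k) by exact: coord_continuous.
have cx j : continuous (fun v => x v j).
  apply: continuous_big; first exact: add_continuous.
  move=> k _ v; pose c : 'rV[R]_n -> R := fun=> a (enum_val k) j.
  have h : {for v, continuous c} by exact: cst_continuous.
  exact: (continuousM (cc k v) h).
have cF : continuous F.
  apply: continuous_big; first exact: add_continuous.
  move=> j _ v; have cm : {for v, continuous (fun v => Num.max 0 (- x v j))}.
    by apply: continuous_max; [exact: cst_continuous | exact: continuousN (cx j v)].
  exact: (continuousM cm cm).
have cS : compact S.
  apply: compact_closedI.
    apply: (@rV_compact R n (fun=> `[0, 1]%classic)) => _.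
    exact: segment_compact.
  apply: preimage_closed; last exact: closed_eq.
  move=> v _; apply: continuous_big; first exact: add_continuous.
  by move=> k _; exact: cc.
have S0 : (S !=set0)%classic.
  exists (delta_mx ord0 (enum_rank i0)); split => [k|] /=.
    by rewrite mxE eqxx /= in_itv /=; case: (k == _) => /=; rewrite ?lexx ?ler01.
  rewrite (bigD1 (enum_rank i0)) //= mxE !eqxx big1 ?addr0 // => k /negbTE ki.
  by rewrite mxE ki andbF.
have [v /set_mem [v01 v1] vmin] := EVT_min_rV S0 cS (continuous_subspaceT cF).
pose w j := Num.max 0 (- x v j).
have w0 j : 0 <= w j by rewrite le_max lexx.
have [i hi] := hw w w0.
pose d j := a i j - x v j.
(* Up to the factor [-2], this sum is the derivative of [F] at its minimizer [v] towards the vertex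
   [i]. *)
have slope : \sum_j w j * d j <= 0.
  suff : 2 * \sum_j w j * d j <= 0 by rewrite pmulr_rle0.
  apply: (@le0_of_small_slope _ _ (\sum_j d j ^+ 2)) => t t0 t1.
  pose u : 'rV[R]_n :=
    \row_k ((1 - t) * v ord0 k + t * (k == enum_rank i)%:R).
  have sum_u (f : 'I_n -> R) :
      \sum_k u ord0 k * f k =
      (1 - t) * (\sum_k v ord0 k * f k) + t * f (enum_rank i).
    under eq_bigr => k _ do rewrite mxE mulrDl -!mulrA.
    rewrite big_split /= -!mulr_sumr; congr (_ + t * _).
    rewrite (bigD1 (enum_rank i)) //= eqxx mul1r big1 ?addr0 // => k /negbTE ->.
    by rewrite mul0r.
  have uS : S u.
    split => [k|] /=.
      have /= := v01 k; rewrite mxE !in_itv /= => /andP[? ?].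
      by case: (k == _) => /=; apply/andP; split; nra.
    under eq_bigr do rewrite -[u _ _]mulr1.
    rewrite sum_u; under eq_bigr do rewrite mulr1.
    by move: v1 => /= ->; ring.
  have := vmin u (mem_set uS).
  (* This quadratic in [t] bounds [F u] and has the same value as [F u] and
     slope [- 2 * \sum_j w j * d j] at [t = 0]. *)
  have Fu : F u <= \sum_j (w j - t * d j) ^+ 2.
    apply: ler_sum => j _; rewrite -[leRHS]real_normK ?num_real //.
    rewrite lerXn2r ?nnegrE ?le_max ?lexx //.
    rewrite ge_max normr_ge0 /= (le_trans _ (ler_norm _)) //.
    have -> : x u j = x v j + t * d j.
      by rewrite /x sum_u enum_rankK /d -/(x v j); ring.
    have : - x v j <= w j by rewrite le_max lexx orbT.
    by lra.
  move=> /le_trans /(_ Fu).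
  under [leRHS]eq_bigr => j _.
    have -> : (w j - t * d j) ^+ 2 =
      w j ^+ 2 + (t ^+ 2 * d j ^+ 2 - t * (2 * (w j * d j))) by ring.
    over.
  rewrite big_split /= sumrB -!mulr_sumr lerDl subr_ge0 expr2 -mulrA.
  by rewrite ler_pM2l.
have wx j : w j * x v j = - w j ^+ 2.
  by rewrite /w; case: (leP 0 (- x v j)) => _; ring.
(* By [wx], [slope] reads [\sum_j w j * a i j + \sum_j w j ^+ 2 <= 0], and [hi] makes the first sum
   nonnegative. *)
have sq0 : \sum_j w j ^+ 2 <= 0.
  move: slope; under eq_bigr do rewrite mulrBr wx opprK.
  by rewrite big_split /=; lra.
have w_eq0 j : w j = 0.
  apply/eqP; rewrite -sqrf_eq0 eq_le sqr_ge0 andbT (le_trans _ sq0) //.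
  by rewrite (bigD1 j) //= lerDl sumr_ge0 // => k _; exact: sqr_ge0.
exists (fun i => v ord0 (enum_rank i)); split => [i'||j].
- by have /= := v01 (enum_rank i'); rewrite in_itv /= => /andP[].
- rewrite -[RHS]v1 /= [RHS](reindex enum_rank) //.
  exact/onW_bij/enum_rank_bij.
- have -> : \sum_i v ord0 (enum_rank i) * a i j = x v j.
    rewrite /x [RHS](reindex enum_rank) /=; last exact/onW_bij/enum_rank_bij.
    by apply: eq_bigr => k _; rewrite enum_rankK.
  by have := w_eq0 j; rewrite /w; case: (leP 0 (- x v j)) => ? ?; lra.
Qed.

(** * Laws of finitely valued random variables *)

Lemma bigcup_fibers (T : Type) (B : finType) (X : T -> B) (Q : pred B) :
  [set t | Q (X t)]%classic =
    (\bigcup_(b in [set` Q]) [set t | X t = b])%classic.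
Proof. by apply/seteqP; split => [t Qt|t [b Qb /= ->]] //; exists (X t). Qed.

Lemma measurable_fibers d (T : measurableType d) (B : finType) (X : T -> B)
    (Q : pred B) :
  (forall b, measurable [set t | X t = b]%classic) ->
  measurable [set t | Q (X t)]%classic.
Proof.
move=> mX; rewrite bigcup_fibers.
by apply: fin_bigcup_measurable => //; exact: finite_finset.
Qed.

Lemma prob_fibers d (T : measurableType d) (R : realType)
    (P : probability T R) (B : finType) (X : T -> B) (Q : pred B) :
  (forall b, measurable [set t | X t = b]%classic) ->
  fine (P [set t | Q (X t)]%classic) =
    \sum_(b | Q b) fine (P [set t | X t = b]%classic).
Proof.
move=> mX.
rewrite bigcup_fibers measure_fin_bigcup //; last first.
  by move=> b c _ _ [t [/= <- <-]].
rewrite -(@bigfs _ _ _ _ (index_enum B)) ?index_enum_uniq // => [|b _]; last first.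
  by rewrite mem_index_enum.
by rewrite -sum_fine // => b _; exact: fin_num_measure.
Qed.

(** The law is carried by [nat] because every subset of [nat] is measurable, so a policy drawn from
    it is measurable for free. *)
Lemma finite_law (R : realType) (I : finType) (p : I -> R) :
  (forall i, 0 <= p i) -> \sum_i p i = 1 ->
  exists (P : probability nat R) (X : nat -> I),
    forall i, fine (P [set k | X k = i]%classic) = p i.
Proof.
move=> p0 p1.
have [i0 _] : exists i0 : I, True.
  apply: contrapT => h; move: p1; rewrite big1 => [/esym/eqP|i _].
    by rewrite oner_eq0.
  by case: h; exists i.
(* Every [k] beyond the enumeration falls on the default [i0]; this is harmless, as [m] charges only
   [k < #|I|]. *)
pose X k := nth i0 (enum I) k.
pose c k : {nonneg R} := NngNum (p0 (X k)).
pose m : {measure set nat -> \bar R} := msum (fun k => mscale (c k) \d_k) #|I|.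
have sumE (f : I -> R) : \sum_(k < #|I|) f (X k) = \sum_i f i.
  rewrite [RHS](reindex (@enum_val I predT)); last exact/onW_bij/enum_val_bij.
  by apply: eq_bigr => k _; rewrite (enum_val_nth i0).
have mE A : m A = (\sum_(k < #|I|) p (X k) * ((k : nat) \in A)%:R)%:E.
  by rewrite -sumEFin.
have m1 : m setT = 1%E.
  rewrite mE; congr EFin; rewrite -[RHS]p1 -(sumE p).
  by apply: eq_bigr => k _; rewrite mem_set // mulr1.
(* [m] has mass 1 already: normalization only packages it as a probability. *)
pose P : probability nat R := mnormalize m \d_0%N.
have PE A : P A = m A by rewrite /P /= /mnormalize m1 onee_eq0 /= invr1 mule1.
exists P, X => i.
have -> : P [set k | X k = i]%classic =
    (\sum_(k < #|I|) p (X k) * (X k == i)%:R)%:E.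
  rewrite PE mE; congr EFin; apply: eq_bigr => k _; congr (_ * _%:R).
  by congr nat_of_bool; apply/idP/eqP; rewrite inE.
rewrite /= (sumE (fun x => p x * (x == i)%:R)) (bigD1 i) //= eqxx mulr1.
rewrite big1 ?addr0 // => x /negbTE ->.
by rewrite mulr0.
Qed.

Lemma measurable_ffun_fiber d (T : measurableType d) (I B : finType)
    (X : T -> {ffun I -> B}) :
  (forall i b, measurable [set t | X t i = b]%classic) ->
  forall f, measurable [set t | X t = f]%classic.
Proof.
move=> mX f.
have -> : [set t | X t = f]%classic =
    (\bigcap_(i in [set: I]) [set t | X t i = f i])%classic.
  apply/seteqP; split => [t /= tf i _ /=|t h]; first by rewrite tf.
  by apply/ffunP => i; exact: h.
by apply: fin_bigcap_measurable => // i _; exact: mX.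
Qed.

(** * Outcome events of online algorithms *)

(** Whether [e] is accepted depends on the policy at a single history, which [policy_measurable]
    covers; the event is a finite intersection over [e]. *)
Lemma measurable_accepted (R : realType) (E : finType) (X : Type)
    (g : online_alg R E X) (x : E -> X) (s : seq E) (S : {set E}) :
  measurable [set t : seed g | accepted (policy_of t) x s = S]%classic.
Proof.
have -> : [set t : seed g | accepted (policy_of t) x s = S]%classic =
  (\bigcap_(e in [set: E])
    [set t : seed g | (e \in accepted (policy_of t) x s) = (e \in S)])%classic.
  apply/seteqP; split => [t /= tS e _ /=|t h]; first by rewrite tS.
  by apply/setP => e; exact: h.
apply: fin_bigcap_measurable => // e _.
set h := [seq (i, x i) | i <- take (index e s).+1 s].
have mh := policy_measurable g h.
have hE (t : seed g) : (e \in accepted (policy_of t) x s) = policy_of t h.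
  by rewrite inE.
case: (e \in S).
  rewrite (_ : mkset _ = [set t | policy_of t h]%classic) //.
  by apply/seteqP; split => t; rewrite /= hE.
rewrite (_ : mkset _ = ~` [set t | policy_of t h])%classic; first exact: measurableC.
by apply/seteqP; split => t; rewrite /= hE; [move=> -> | move/negP/negbTE].
Qed.

Lemma outcome_prob_comp (R : realType) (E : finType) (X : Type)
    (g : online_alg R E X) (out : policy E X -> seq E -> {set E})
    (h : {set E} -> {set E}) (S : {set E}) :
  (forall s S', measurable [set t : seed g | out (policy_of t) s = S']%classic) ->
  outcome_prob g (fun a s => h (out a s)) S =
    \sum_(S' | h S' == S) outcome_prob g out S'.
Proof.
move=> mout; rewrite /outcome_prob -mulr_sumr exchange_big /=; congr (_ * _).
apply: eq_bigr => s _.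
rewrite -(prob_fibers _ (fun S' => h S' == S)) //.
by congr (fine (_ _)); apply/seteqP; split => t /= /eqP.
Qed.

(** * From feasible online algorithms to contention resolution maps *)

Section Crm_of_alg.
Variables (R : realType) (E : finType) (M : matroid E).

Definition crm_feasible (g : online_alg R E bool) : Prop :=
  forall (t : seed g) (A : {set E}) (s : {perm E}),
    indep M (crm_run A (policy_of t) (arrival s)).

Lemma perms_gt0 : 0 < #|{perm E}|%:R :> R.
Proof. by rewrite ltr0n; apply/card_gt0P; exists 1%g. Qed.

Section Alg.
Variable (g : online_alg R E bool).

Lemma measurable_crm_run A s (S : {set E}) :
  measurable [set t : seed g | crm_run A (policy_of t) s = S]%classic.
Proof.
rewrite /crm_run (_ : mkset _ = [set t : seed g | [pred S' | A :&: S' == S]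
    (accepted (policy_of t) (fun e => e \in A) s)]%classic); last first.
  by apply/seteqP; split => t /= /eqP.
by apply: measurable_fibers => b; exact: measurable_accepted.
Qed.

Lemma outcome_prob_ge0 A S : 0 <= outcome_prob g (crm_run A) S.
Proof.
rewrite mulr_ge0 ?invr_ge0 ?ler0n // sumr_ge0 // => s _.
by rewrite fine_ge0.
Qed.

Lemma outcome_prob_sum1 A : \sum_S outcome_prob g (crm_run A) S = 1.
Proof.
rewrite -mulr_sumr exchange_big /= (eq_bigr (fun=> 1)) => [|s _].
  by rewrite sumr_const mulVf // gt_eqF // perms_gt0.
rewrite -(prob_fibers _ xpredT) => [|S]; last exact: measurable_crm_run.
rewrite (_ : mkset _ = setT) ?probability_setT //.
by apply/seteqP; split.
Qed.

Hypothesis feas : crm_feasible g.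

(** Feasibility holds for every seed, so an inadmissible outcome is an empty event. *)
Lemma outcome_prob_supp A S : outcome_prob g (crm_run A) S != 0 ->
  (S \subset A) && indep M S.
Proof.
apply: contraTT => SA; rewrite negbK mulf_eq0; apply/orP; right.
rewrite big1 // => s _; rewrite (_ : mkset _ = set0) ?measure0 //.
apply/seteqP; split => // t /= tS; move: SA; rewrite -tS.
by rewrite finset.subsetIl feas.
Qed.

Definition crm_of_alg : crm R M :=
  Crm (crm_law := fun A => Dist (outcome_prob_ge0 A) (outcome_prob_sum1 A))
    outcome_prob_supp.

Lemma crm_of_alg_online : online_crm crm_of_alg.
Proof. by exists g. Qed.

End Alg.

End Crm_of_alg.

(** * Simulating the secretary algorithm on masked weights, and derandomizing *)

Section Reduction.
Variables (R : realType) (E : finType) (M : matroid E).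

Definition select_prob (D : dist R {set E}) (phi : crm R M) (i : E) : R :=
  \sum_(A : {set E}) D A * pr (phi A) (fun S => i \in S).

Definition masked (w : E -> R) (A : {set E}) : E -> R :=
  fun e => if e \in A then w e else 0.

Lemma set_weight_masked w A S :
  set_weight (masked w A) S = set_weight w (A :&: S).
Proof.
rewrite /set_weight /masked -big_mkcondr; apply: eq_bigl => e.
by rewrite inE andbC.
Qed.

Lemma set_weight_le_max (w : E -> R) S :
  indep M S -> set_weight w S <= max_indep_weight M w.
Proof. by move=> MS; rewrite /max_indep_weight (bigD1 S) //= le_max lexx. Qed.

Lemma select_weight D phi (w : E -> R) :
  \sum_i w i * select_prob D phi i = \sum_A D A * \sum_S phi A S * set_weight w S.
Proof.
under eq_bigr do rewrite mulr_sumr.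
rewrite exchange_big /=; apply: eq_bigr => A _.
under eq_bigr do rewrite mulrCA.
rewrite -mulr_sumr; congr (_ * _).
under [RHS]eq_bigr do rewrite mulr_sumr.
under [LHS]eq_bigr => i _ do rewrite /pr mulr_sumr.
rewrite (exchange_big_dep predT) //=; apply: eq_bigr => S _.
by apply: eq_bigr => i _; rewrite mulrC.
Qed.

(** Averaging the competitive inequalities with coefficients [w] compares the left side with the
    expected weight of [phi A]. Each value of [phi A] is an independent subset of [A], on which
    [masked w A] agrees with [w]. *)
Lemma uncontentious_weight (alpha : R) (D : dist R {set E}) (w : E -> R) :
    0 <= alpha -> uncontentious M alpha D -> (forall e, 0 <= w e) ->
  \sum_i w i * pr D (fun A => i \in A) <=
    alpha * \sum_A D A * max_indep_weight M (masked w A).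
Proof.
move=> alpha0 [phi hphi] w0.
apply: (@le_trans _ _ (alpha * \sum_i w i * select_prob D phi i)).
  rewrite mulr_sumr; apply: ler_sum => i _.
  by rewrite mulrCA ler_wpM2l // hphi.
rewrite ler_wpM2l // select_weight; apply: ler_sum => A _.
rewrite ler_wpM2l ?dist_ge0 //.
rewrite -[leRHS]mul1r -(dist_sum1 (phi A)) mulr_suml; apply: ler_sum => S _.
have [->|] := eqVneq (phi A S) 0; first by rewrite !mul0r.
move=> /crm_supp /andP[SA MS]; rewrite ler_wpM2l ?dist_ge0 //.
by rewrite -(finset.setIidPr SA) -set_weight_masked set_weight_le_max.
Qed.

(** The masked weight of an arriving element is computed from [w] and its revealed bit alone, so the
    simulation stays online. *)
Definition masked_policy (w : E -> R) (a : policy E R) : policy E bool :=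
  fun h => a [seq (z.1, if z.2 then w z.1 else 0) | z <- h].

Lemma accepted_masked_policy w a (A : {set E}) s :
  accepted (masked_policy w a) (fun e => e \in A) s = accepted a (masked w A) s.
Proof. by apply/setP => e; rewrite !inE /masked_policy -map_comp. Qed.

Definition masked_alg (w : E -> R) (g : online_alg R E R) : online_alg R E bool :=
  OnlineAlg (seed_law g) (policy_of := fun t => masked_policy w (policy_of t))
    (fun h => policy_measurable g _).

Lemma masked_alg_feasible w g : (forall e, 0 <= w e) ->
  secretary_feasible M g -> crm_feasible M (masked_alg w g).
Proof.
move=> w0 gM t A s; rewrite /crm_run accepted_masked_policy.
(* The secretary policy may accept elements outside [A]; [crm_run] drops them, which preserves
   independence. *)
apply: indepS (gM t (masked w A) s _); first exact: finset.subsetIr.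
by move=> e; rewrite /masked; case: ifP.
Qed.

Lemma masked_alg_weight w g A :
  \sum_S outcome_prob (masked_alg w g) (crm_run A) S * set_weight w S =
    expected_weight g (masked w A).
Proof.
(* Accepted sets are grouped by their trace on [A]; what lies outside [A] has masked weight zero. *)
rewrite /expected_weight [RHS](partition_big (fun S => A :&: S) predT) //=.
apply: eq_bigr => S _.
have -> : outcome_prob (masked_alg w g) (crm_run A) S =
    outcome_prob g (fun a s => A :&: accepted a (masked w A) s) S.
  rewrite /outcome_prob; congr (_ * _); apply: eq_bigr => s _.
  by rewrite /crm_run /=; under eq_fun do rewrite accepted_masked_policy.
rewrite (outcome_prob_comp (fun S => A :&: S)) => [|s S']; last first.
  exact: measurable_accepted.
by rewrite mulr_suml; apply: eq_bigr => S' /eqP <-; rewrite set_weight_masked.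
Qed.

(* There are finitely many behaviours, whereas policies form an infinite type. *)
Definition behaviour : Type := {ffun {set E} * {perm E} -> {set E}}.

Definition policy_behaviour (a : policy E bool) : behaviour :=
  [ffun z => crm_run z.1 a (arrival z.2)].

(** That one policy produces the outputs for all pairs at once is what makes a behaviour online. *)
Definition realizable (b : behaviour) : Prop :=
  exists a : policy E bool, policy_behaviour a = b /\
    forall A (s : {perm E}), indep M (crm_run A a (arrival s)).

Definition behaviour_select_prob (D : dist R {set E}) (b : behaviour) (i : E) : R :=
  \sum_A D A * (#|{perm E}|%:R^-1 * \sum_(s : {perm E}) (i \in b (A, s))%:R).

Lemma measurable_policy_behaviour (g : online_alg R E bool) b :
  measurable [set t : seed g | policy_behaviour (policy_of t) = b]%classic.
Proof.
apply: measurable_ffun_fiber => z S.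
under eq_set do rewrite ffunE.
exact: measurable_crm_run.
Qed.

(** Conditioning on [X]. The index type is left general to cover both the behaviour of a seed itself
    and the label drawn in a mixture. *)
Lemma select_prob_crm_of_alg D (g : online_alg R E bool) (gM : crm_feasible M g)
    (I : finType) (X : seed g -> I) (b : I -> behaviour) :
    (forall x, measurable [set t | X t = x]%classic) ->
    (forall t, policy_behaviour (policy_of t) = b (X t)) ->
  forall i, select_prob D (crm_of_alg gM) i =
    \sum_x fine (seed_law g [set t | X t = x]%classic) *
      behaviour_select_prob D (b x) i.
Proof.
move=> mX bX i; rewrite /select_prob /behaviour_select_prob.
under [RHS]eq_bigr do rewrite mulr_sumr.
rewrite [RHS]exchange_big /=; apply: eq_bigr => A _.
under [RHS]eq_bigr do rewrite mulrCA.
rewrite -mulr_sumr; congr (_ * _).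
under [RHS]eq_bigr do rewrite mulrCA.
rewrite -mulr_sumr /pr /= /outcome_prob -mulr_sumr; congr (_ * _).
under [RHS]eq_bigr do rewrite mulr_sumr.
rewrite exchange_big [RHS]exchange_big /=; apply: eq_bigr => s _.
rewrite -(prob_fibers _ (fun S : {set E} => i \in S)) => [|S]; last first.
  exact: measurable_crm_run.
under [RHS]eq_bigr do rewrite mulr_natr mulrb.
rewrite -big_mkcond -(prob_fibers _ (fun x => i \in b x (A, s))) //.
congr (fine (_ _)); apply/seteqP.
by split => t /=; rewrite -bX ffunE.
Qed.

(** The selected weight is an average over behaviours, so one of positive probability reaches [c];
    positive probability yields a seed, whose policy realizes it. *)
Lemma realizable_select_weight D (g : online_alg R E bool) (gM : crm_feasible M g)
    (w : E -> R) (c : R) :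
  c <= \sum_i w i * select_prob D (crm_of_alg gM) i ->
  exists2 b, realizable b & c <= \sum_i w i * behaviour_select_prob D b i.
Proof.
move=> hc; apply: contrapT => nob.
pose q b := fine (seed_law g
  [set t | policy_behaviour (policy_of t) = b]%classic).
have q1 : \sum_b q b = 1.
  rewrite -(prob_fibers _ xpredT); last exact: measurable_policy_behaviour.
  by rewrite (_ : mkset _ = setT) ?probability_setT //; apply/seteqP; split.
have hq : \sum_i w i * select_prob D (crm_of_alg gM) i =
    \sum_b q b * \sum_i w i * behaviour_select_prob D b i.
  under [RHS]eq_bigr do rewrite mulr_sumr.
  rewrite [RHS]exchange_big /=; apply: eq_bigr => i _.
  rewrite (select_prob_crm_of_alg D gM (b := id) (measurable_policy_behaviour g)) //.
  by rewrite mulr_sumr; apply: eq_bigr => b _; rewrite mulrCA.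
have q0 b : 0 <= q b by rewrite fine_ge0.
have qlt b : q b != 0 -> \sum_i w i * behaviour_select_prob D b i < c.
  move=> qb; rewrite ltNge; apply/negP => cb; apply: nob; exists b => //.
  have [t tb] : exists t : seed g, policy_behaviour (policy_of t) = b.
    apply: contrapT => not; move: qb; rewrite /q (_ : mkset _ = set0).
      by rewrite measure0 eqxx.
    by apply/seteqP; split => // t tb; case: not; exists t.
  by exists (policy_of t); split => // A s; exact: gM.
(* A behaviour of positive mass makes the comparison of averages strict. *)
have [b0 qb0] : exists b, q b != 0.
  apply: contrapT => not; move: q1; rewrite big1 => [/esym/eqP|b _].
    by rewrite oner_eq0.
  by apply/eqP/negP => /negP qb; case: not; exists b.
move: hc; rewrite hq leNgt => /negP; apply.
rewrite -[ltRHS]mul1r -q1 mulr_suml (bigD1 b0) //= [ltRHS](bigD1 b0) //=.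
apply: ltr_leD; first by rewrite ltr_pM2l ?qlt // lt_def qb0 q0.
apply: ler_sum => b _.
have [->|/qlt/ltW ?] := eqVneq (q b) 0; first by rewrite !mul0r.
by rewrite ler_wpM2l.
Qed.

End Reduction.

(** * Mixing behaviours and concluding by the alternative *)

Section Main.
Variables (R : realType) (E : finType) (M : matroid E).

(** The seed draws an index from [p] once, before any arrival, and then follows a policy chosen for
    that behaviour. *)
Lemma realizable_mixture (K : finType) (b : K -> behaviour E) (p : K -> R) :
    (forall x, realizable M (b x)) ->
    (forall x, 0 <= p x) -> \sum_x p x = 1 ->
  exists2 phi : crm R M, online_crm phi &
    forall D i, select_prob D phi i = \sum_x p x * behaviour_select_prob D (b x) i.
Proof.
move=> hb p0 p1.
have [pol hpol] := choice hb.
have [P [X PX]] := finite_law p0 p1.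
pose g : online_alg R E bool :=
  OnlineAlg P (policy_of := fun k => pol (X k)) (fun h => I).
have gM : crm_feasible M g by move=> k A s; have [_] := hpol (X k); apply.
exists (crm_of_alg gM) => [|D i]; first exact: crm_of_alg_online.
rewrite (select_prob_crm_of_alg D gM (X := X) (b := b)) => [|//|k].
  by apply: eq_bigr => x _; rewrite PX.
by have [] := hpol (X k).
Qed.

(** Rejecting everything supplies a value of the scheme at distributions that are not
    uncontentious. *)
Lemma online_crm_exists : exists phi : crm R M, online_crm phi.
Proof.
pose a : policy E bool := fun=> false.
have aM : realizable M (policy_behaviour a).
  exists a; split => // A s; rewrite /crm_run (_ : accepted _ _ _ = finset.set0).
    by rewrite finset.setI0 indep0.
  by apply/setP => e; rewrite !inE.
have [//|_||phi ? _] := @realizable_mixture unit (fun=> policy_behaviour a) (fun=> 1).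
- exact: ler01.
- by rewrite big_const card_unit /= addr0.
- by exists phi.
Qed.

Lemma online_contention_resolution (gamma alpha : R) (g : online_alg R E R)
    (D : dist R {set E}) :
    0 < gamma -> 1 <= alpha ->
    secretary_feasible M g -> secretary_competitive M gamma g ->
    uncontentious M alpha D ->
  exists phi : crm R M, online_crm phi /\ crm_competitive (gamma * alpha) D phi.
Proof.
move=> gamma0 alpha1 gM gC hD.
pose I : finType := {b : behaviour E | `[< realizable M b >]}.
have Ireal (x : I) : realizable M (val x) by apply/asboolP/(valP x).
pose p i := pr D (fun A => i \in A).
have alpha0 : 0 <= alpha by rewrite (le_trans ler01).
have ga0 : 0 < gamma * alpha by rewrite mulr_gt0 // (lt_le_trans ltr01).
(* With these entries, nonnegative column averages say that the mixture is
   [gamma * alpha]-competitive. *)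
have [|q [q0 q1 hq]] :=
  @ville_alternative R I E (fun x i => gamma * alpha * behaviour_select_prob D (val x) i - p i).
  move=> w w0.
  have w0A A e : 0 <= masked w A e by rewrite /masked; case: ifP.
  (* The factor [alpha] is lost in [uncontentious_weight], and [gamma] in [gC] applied to each
     [masked w A]. *)
  have hw : (gamma * alpha)^-1 * \sum_i w i * p i <=
      \sum_i w i * select_prob D (crm_of_alg (masked_alg_feasible w0 gM)) i.
    rewrite select_weight mulrC ler_pdivrMr //.
    apply: (le_trans (uncontentious_weight alpha0 hD w0)).
    rewrite [leRHS]mulrA [leRHS]mulrC ler_wpM2l // mulr_suml.
    apply: ler_sum => A _; rewrite -mulrA ler_wpM2l ?dist_ge0 //.
    rewrite masked_alg_weight.
    by have := gC (masked w A) (w0A A); rewrite mulrC ler_pdivrMr.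
  have [b bM hb] := realizable_select_weight hw.
  have bI : `[< realizable M b >] by apply/asboolP.
  exists (exist _ b bI) => /=.
  under eq_bigr do rewrite mulrBr mulrCA.
  rewrite sumrB subr_ge0 -mulr_sumr.
  by move: hb; rewrite mulrC ler_pdivrMr // mulrC.
have [phi phi_on hphi] := realizable_mixture Ireal q0 q1.
exists phi; split => // i.
have := hq i; under eq_bigr do rewrite mulrBr mulrCA.
rewrite sumrB -mulr_sumr -mulr_suml q1 mul1r subr_ge0 -hphi.
exact.
Qed.

End Main.

Theorem theorem5 (R : realType) (E : finType) (M : matroid E) (gamma : R) :
  0 < gamma ->
  (exists g : online_alg R E R,
     secretary_feasible M g /\ secretary_competitive M gamma g) ->
  forall alpha : R, 1 <= alpha ->
    (forall D : dist R {set E}, uncontentious M alpha D ->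
       exists phi : crm R M,
         online_crm phi /\ crm_competitive (gamma * alpha) D phi) /\
    (exists Phi : crs R M,
       online_crs Phi /\ crs_universal alpha (gamma * alpha) Phi).
Proof.
move=> gamma0 [g [gM gC]] alpha alpha1.
have crmD D : uncontentious M alpha D -> exists phi : crm R M,
    online_crm phi /\ crm_competitive (gamma * alpha) D phi.
  exact: online_contention_resolution gM gC.
split=> //.
(* A scheme must be online at every [D], so competitiveness alone is made conditional before
   choosing. *)
have /choice[Phi hPhi] : forall D : dist R {set E}, exists phi : crm R M,
    online_crm phi /\
    (uncontentious M alpha D -> crm_competitive (gamma * alpha) D phi).
  move=> D; have [/crmD[phi [? ?]]|nD] := pselect (uncontentious M alpha D).
    by exists phi.
  by have [phi ?] := online_crm_exists R M; exists phi.
by exists Phi; split=> D; [have [] := hPhi D | have [_] := hPhi D].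
Qed.
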